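(* For every system $f_1,\dots,f_s$ ($s\ge 1$) of univariate tropical polynomials (in convex form) the tropical effective dual Nullstellensatz holds with $N\le 4\cdot(\mathrm{trdeg}(f_1)+\cdots+\mathrm{trdeg}(f_s))$. That is, there is an integer-valued function $N=N(\mathrm{trdeg}(f_1),\dots,\mathrm{trdeg}(f_s))\ge 0$, depending only on the tropical degrees, satisfying $N\le 4\cdot(\mathrm{trdeg}(f_1)+\cdots+\mathrm{trdeg}(f_s))$, such that the following holds: $f_1,\dots,f_s$ have a common tropical zero $x\in\mathbb{R}$ if and only if the matrix $C_N=C_N(f_1,\dots,f_s)$ has a tropical zero.
   Context: The tropical semi-ring is $\mathbb{R}_\infty=\mathbb{R}\cup\{\infty\}$ with $\oplus=\min$, $\otimes=+$. Zeros are taken over $\mathbb{R}$. A univariate tropical polynomial $f$ is a finite tropical sum $\bigoplus_l a_l\otimes X^{\otimes i_l}$ with finite coefficients $a_l\in\mathbb{R}$ and pairwise distinct integer exponents $i_l\ge 0$ (at least one monomial). An absent monomial has coefficient $\infty$. $\mathrm{trdeg}(f)$ is the maximal exponent $i_l$ occurring in $f$. A point $x\in\mathbb{R}$ is a tropical zero of $f$ if $\min_l\{a_l+i_l x\}$ is attained for at least two different $l$. A tropical zero of a system is a common tropical zero of all its members. The (extended) Newton polyhedron $P(f)\subset\mathbb{R}^2$ is the convex hull of the points $(a_l,i_l)$, enlarged by adding, for each point $(a,b)$ of this convex hull, the ray $\{(a',b): a'\ge a\}$. $f$ is in convex form if its monomials are exactly those $a\otimes X^{\otimes i}$ with $i\in\mathbb{Z}$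 such that $(a,i)\in P(f)$ for some $a$, with the coefficient $a$ being the minimal such value. Replacing a tropical polynomial by its convex form does not change its tropical zeros. All tropical polynomials are considered in convex form. The Cayley matrix $C=C(f_1,\dots,f_s)$ over $\mathbb{R}_\infty$ has columns indexed by $I\in\mathbb{Z}$ (the monomials $X^{\otimes I}$) and rows indexed by pairs $(i,j)$, $i\in\mathbb{Z}$, $1\le j\le s$. The row $(i,j)$ consists of the coefficients of $X^{\otimes i}\otimes f_j$, i.e. its entry in column $I$ is the coefficient of $X^{\otimes(I-i)}$ in $f_j$ ($\infty$ if absent). For an integer $N\ge 0$, $C_N$ is the finite submatrix of $C$ formed by the rows $(i,j)$ with $|i|\le N$, $1\le j\le s$, and by those columns which contain at least one finite entry in one of these rows. A tropical zero of a matrix $(c_{k,I})$ over $\mathbb{R}_\infty$ is a vector $(y_I)_I$ with all $y_I\in\mathbb{R}$, indexed by the columns, such that for every row $k$ the minimum $\min_I\{c_{k,I}+y_I\}$ is attained for at least two different columns $I$. *)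

(* Defs.v *)
From mathcomp Require Import all_boot all_order all_algebra.
From mathcomp Require Import finmap.
From mathcomp Require Import boolp classical_sets reals ereal convex.

Set Implicit Arguments.
Unset Strict Implicit.
Unset Printing Implicit Defensive.

Import Order.TTheory GRing.Theory Num.Theory.

Local Open Scope classical_set_scope.
Local Open Scope ring_scope.

(* R_oo is embedded in \bar R (-oo never occurs), with tropical sum the minimum
   and tropical product the addition.  A univariate tropical polynomial is the
   finite map sending each exponent occurring in it to its finite coefficient;
   it has at least one monomial. *)
Record tpoly (R : realType) : Type := TPoly {
  tmonom : {fmap nat -> R};
  tmonom_neq0 : tmonom != [fmap]%fmap }.

Section TropicalPolynomials.
Variable R : realType.
Implicit Types f : tpoly R.

Definition tcoef f (n : int) : \bar R :=
  match n with
  | Posz k => if (tmonom f).[? k]%fmap is Some a then a%:E else +oo%E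
  | Negz _ => +oo%E
  end.

Definition trdeg f : nat := (\max_(i <- domf (tmonom f)) i)%N.

(* The minimum of the family v is attained for at least two indices. *)
Definition min_twice (J : Type) (v : J -> \bar R) : Prop :=
  exists j1 j2 : J,
    [/\ j1 <> j2, v j1 = v j2 & forall j, (v j1 <= v j)%E].

Definition tzero f (x : R) : Prop :=
  min_twice (fun l : domf (tmonom f) => (tmonom f l + x *+ val l)%:E).

(* The coefficient is the first coordinate, the exponent the second one; R^o is
   R as a module over itself. *)
Definition newton_points f : set (R^o * R^o) :=
  [set p | exists2 i : nat, (tmonom f).[? i]%fmap = Some p.1 & p.2 = i%:R].

Definition convex_hull (A : set (R^o * R^o)) : set (R^o * R^o) :=
  smallest (fun C => convex_set C) A.

Definition newton_polyhedron f : set (R^o * R^o) :=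
  [set p | exists2 a, convex_hull (newton_points f) (a, p.2) & a <= p.1].

Definition convex_form f : Prop :=
  forall (i : int) (a : R),
    tcoef f i = a%:E <->
    newton_polyhedron f (a, i%:~R) /\
    (forall a', newton_polyhedron f (a', i%:~R) -> a <= a').

(* Tropical zero of a matrix over R_oo with rows K and columns J. *)
Definition mx_tzero (K J : Type) (c : K -> J -> \bar R) (y : J -> R) : Prop :=
  forall k, min_twice (fun j => (c k j + (y j)%:E)%E).

Section Cayley.
Variables (s : nat) (f : 'I_s -> tpoly R).

Definition cayley (k : int * 'I_s) (I : int) : \bar R := tcoef (f k.2) (I - k.1).

Definition cayley_rows (N : nat) : set (int * 'I_s) := [set k | (`|k.1| <= N)%N].

Definition cayley_cols (N : nat) : set int :=
  [set I | exists2 k, cayley_rows N k & cayley k I \is a fin_num].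

Definition cayleyN (N : nat) (k : cayley_rows N) (I : cayley_cols N) : \bar R :=
  cayley (val k) (val I).

End Cayley.

End TropicalPolynomials.

Arguments cayleyN {R s} f N k I.

(* Main.v *)
Require Import Defs.
From mathcomp Require Import all_boot all_order all_algebra.
From mathcomp Require Import finmap.
From mathcomp Require Import boolp classical_sets reals ereal convex.
From mathcomp Require Import unstable interval_inference zify ring lra.

(** Given a zero [y] of the matrix, the row [(i, j)] says that a translate by
    [i] of the concave cap [- f_j], raised as far as possible, stays below [y]
    and touches it at two points or more. The upper envelope [Phi_j] of these
    caps is concave because every row touches twice, and the successive slopes
    of its edges are essentially tropical zeros of [f_j]. For two polynomials
    [f], [g], on a stretch where the slope of [Phi_f] exceeds that of [Phi_g]
    the difference [Phi_f - Phi_g] increases; while it is negative [Phi_f] does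
    not touch [y], while it is positive [Phi_g] does not. Between touching
    points an envelope runs once through consecutive edges of a single cap, so
    the slopes differ on at most [2 (deg f + deg g)] edges, not counting the edges
    where a slope drops. Comparing every polynomial with one of least degree, at
    most [5 n] edges are bad, where [n = deg f_1 + ... + deg f_s]; with [N = 4 n]
    all envelopes live on a common stretch of [7 n - 1] edges, so the slopes
    agree on one of them, and their common value is a common zero. *)

Set Implicit Arguments.
Unset Strict Implicit.
Unset Printing Implicit Defensive.

Section Caps.
Import Order.TTheory GRing.Theory Num.Theory.
Local Open Scope ring_scope.

(** * Counting tools *)

Lemma card_le_interval (H a b : nat) (A : {set 'I_H}) (eps : nat -> nat) :
    (forall I : 'I_H, I \in A -> (a < eps I <= b)%N) ->
    (forall I I' : 'I_H, I \in A -> I' \in A -> (I < I')%N -> eps I <> eps I') ->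
  (#|A| <= b - a)%N.
Proof.
move=> epsA eps_inj; rewrite cardE -(size_map (eps \o val)) -(size_iota a.+1 (b - a)).
apply: uniq_leq_size => [|e /mapP[I]].
  rewrite map_inj_in_uniq ?enum_uniq // => I I'; rewrite !mem_enum => IA I'A /= eqe.
  apply: val_inj; case: (ltngtP (val I) (val I')) => // [/eps_inj|/eps_inj] h.
    by case: (h IA I'A).
  by case: (h I'A IA).
by rewrite mem_enum mem_iota => /epsA /= ? ->; lia.
Qed.

Lemma leq_card_bigcup (T I : finType) (F : I -> {set T}) :
  (#|\bigcup_i F i| <= \sum_i #|F i|)%N.
Proof.
elim/big_rec2: _ => [|i n A _ IH]; first by rewrite cards0.
by apply: leq_trans (leq_card_setU _ _).1 _; rewrite leq_add2l.
Qed.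

(** * Translates of a concave cap and their upper envelope *)

Variable R : realFieldType.
Implicit Types (a b M i I : nat) (c y Phi : nat -> R) (eps : nat -> nat).

(* The tropical zero carried by the edge between the exponents [e.-1] and [e]. *)
Definition slope c (e : nat) : R := c e.-1 - c e.

Definition slope_decr a b c :=
  forall e e', (a < e)%N -> (e <= e')%N -> (e' <= b)%N -> slope c e' <= slope c e.

Definition touches_twice a b c y (i : nat) := exists k1 k2 : nat,
  [/\ (a <= k1)%N, (k1 < k2)%N, (k2 <= b)%N,
      c k1 + y (i + k1)%N = c k2 + y (i + k2)%N &
      forall k, (a <= k <= b)%N -> c k1 + y (i + k1)%N <= c k + y (i + k)%N].

Definition cap c (m : nat -> R) i I : R := m i - c (I - i)%N.

Lemma cap_step c m i I : (i <= I)%N ->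
  cap c m i I.+1 = cap c m i I + slope c (I.+1 - i)%N.
Proof.
move=> iI; rewrite /cap /slope.
have -> : ((I.+1 - i).-1 = I - i)%N by lia.
lra.
Qed.

(** On each edge the later translate [i'] is at an earlier exponent of [c], where the slope is at
    least as large. The difference of the two caps therefore grows, and they cross at most once. *)
Lemma cap_cross a b c m i i' I I' : slope_decr a b c ->
  (i < i')%N -> (i' + a <= I)%N -> (I <= I')%N -> (I' <= i + b)%N ->
  cap c m i' I - cap c m i I <= cap c m i' I' - cap c m i I'.
Proof.
move=> cD ii' aI; elim: I' => [|I' IH] II' Ib.
  by have -> : I = 0%N by lia.
have [<-//|nII'] := eqVneq I I'.+1.
have {}IH := IH ltac:(lia) ltac:(lia).
rewrite !cap_step; [|lia|lia].
have := cD (I'.+1 - i')%N (I'.+1 - i)%N ltac:(lia) ltac:(lia) ltac:(lia).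
lra.
Qed.

(* [Phi] is the envelope and [eps I] the edge of the cap followed by [Phi] between
   [I] and [I.+1]; it advances by one as long as [Phi] does not touch [y]. *)
Definition envelope_at a b c y eps Phi I :=
  [/\ (a < eps I <= b)%N,
      Phi I.+1 = y I.+1 \/ eps I.+1 = (eps I).+1,
      Phi I <= y I,
      slope c (eps I) <= Phi I.+1 - Phi I &
      Phi I.+2 - Phi I.+1 <= slope c (eps I)].

(** [Phi] is the maximum of the caps. Let [t] be the last row whose first chosen touching point is
    at most [I]. Caps before [t] are dominated at [I] by cap [t], caps beyond [t.+1] are dominated
    at [I.+2] by cap [t.+1]; this sandwiches the slope of edge [I.+1 - t] between two consecutive
    increments of [Phi]. *)
Lemma envelope_exists a b c y M : slope_decr a b c -> (0 < M)%N ->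
    (forall i, (i < M)%N -> touches_twice a b c y i) ->
  exists eps Phi, forall I, (b <= I)%N -> (I.+2 < M + b)%N ->
    envelope_at a b c y eps Phi I.
Proof.
move=> cD M0 yT.
have /choice [lr lrP] : forall i, exists p : nat * nat, (i < M)%N ->
    [/\ (i + a <= p.1)%N, (p.1 < p.2)%N, (p.2 <= i + b)%N,
      c (p.1 - i)%N + y p.1 = c (p.2 - i)%N + y p.2 &
      forall I, (i + a <= I <= i + b)%N ->
        c (p.1 - i)%N + y p.1 <= c (I - i)%N + y I].
  move=> i; have [iM|] := boolP (i < M)%N; last by exists (0%N, 0%N).
  have [k1 [k2 [h1 h2 h3 h4 h5]]] := yT _ iM.
  exists (i + k1, i + k2)%N => _ /=; split; try lia.
    by rewrite !addKn.
  move=> I II; rewrite addKn.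
  by have := h5 (I - i)%N ltac:(lia); rewrite subnKC; last lia.
pose l i := (lr i).1; pose r i := (lr i).2.
pose m i := c (l i - i)%N + y (l i).
pose K := cap c m.
have lrN i : (i < M)%N -> [/\ (i + a <= l i)%N, (l i < r i)%N & (r i <= i + b)%N].
  by move=> /lrP[].
have Ky i I : (i < M)%N -> (i + a <= I <= i + b)%N -> K i I <= y I.
  by move=> /lrP[_ _ _ _ h] /h; rewrite /K /cap /m /l; lra.
have Kl i : (i < M)%N -> K i (l i) = y (l i).
  by move=> _; rewrite /K /cap /m; lra.
have Kr i : (i < M)%N -> K i (r i) = y (r i).
  by move=> /lrP[_ _ _ h _]; rewrite /K /cap /m /l /r h; lra.
(* At [l i'] the cap [i'] reaches [y], so it is not below cap [i], and by [cap_cross] it stays so to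
   the right; [domR] is the mirror image at [r i]. *)
have domL i i' I : (i < i')%N -> (i' < M)%N -> (l i' <= I)%N -> (I <= i + b)%N ->
    K i I <= K i' I.
  move=> ii' i'M lI Ib; have [h1 h2 h3] := lrN _ i'M.
  have := cap_cross m cD ii' h1 lI Ib.
  have := Ky i (l i') ltac:(lia) ltac:(lia).
  have := Kl i' i'M; rewrite /K; lra.
have domR i i' I : (i < i')%N -> (i' < M)%N -> (I <= r i)%N -> (i' + a <= I)%N ->
    K i' I <= K i I.
  move=> ii' i'M Ir aI; have [h1 h2 h3] := lrN i ltac:(lia).
  have := cap_cross m cD ii' aI Ir h3.
  have := Ky i' (r i) ltac:(lia) ltac:(lia).
  have := Kr i ltac:(lia); rewrite /K; lra.
have /choice [phi phiP] : forall I, exists i, (b <= I)%N -> (I < M + b)%N ->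
    [/\ (i < M)%N, (i + a <= I <= i + b)%N &
     forall i', (i' < M)%N -> (i' + a <= I <= i' + b)%N -> K i' I <= K i I].
  move=> I; have [bI|] := leqP b I; last by exists 0%N; lia.
  have [IM|] := ltnP I (M + b); last by exists 0%N; lia.
  have [h1 h2 h3] := lrN _ M0.
  have i0M : (I - b < M)%N by lia.
  pose rows := [pred i : 'I_M | (i + a <= I <= i + b)%N].
  have rows0 : rows (Ordinal i0M) by rewrite /=; lia.
  case: (arg_maxP (fun i : 'I_M => K i I) rows0) => i Pi imax.
  exists i => _ _; split=> // i' i'M Pi'.
  exact: (imax (Ordinal i'M)).
have /choice [io ioP] : forall I, exists t, (b <= I)%N ->
    [/\ (t < M)%N, (l t <= I)%N & forall i, (i < M)%N -> (t < i)%N -> (I < l i)%N].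
  move=> I; have [bI|] := leqP b I; last by exists 0%N; lia.
  have ex : exists i, (i < M)%N && (l i <= I)%N.
    by exists 0%N; have [] := lrN _ M0; lia.
  have bd i : (i < M)%N && (l i <= I)%N -> (i <= M)%N by lia.
  case: (ex_maxnP ex bd) => t /andP[tM lt] tmax; exists t => _; split=> // i iM ti.
  by rewrite ltnNge; apply/negP => li; have := tmax i; rewrite iM li; lia.
(* [io] jumps only at touching points, so [I.+1 - io I] advances by one in between. *)
exists (fun I => I.+1 - io I)%N, (fun I => K (phi I) I) => I bI IM.
have [tM lt tmax] := ioP I bI.
set t := io I in tM lt tmax *.
(* Caps from [t] on still cover [I.+1]: row [i.+1] first touches after [I] and strictly before its
   right end; for the last row the bound on [I] serves. *)
have rng i : (t <= i)%N -> (i < M)%N -> (I.+1 <= i + b)%N.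
  move=> ti iM; have [iM'|] := ltnP i.+1 M; last by lia.
  by have := tmax i.+1 iM' ltac:(lia); have [] := lrN _ iM'; lia.
have at_t : (t + a <= I)%N by have [] := lrN _ tM; lia.
have tb := rng t (leqnn _) tM.
have [p0M p0r p0max] := phiP I ltac:(lia) ltac:(lia).
have [p1M p1r p1max] := phiP I.+1 ltac:(lia) ltac:(lia).
have [p2M p2r p2max] := phiP I.+2 ltac:(lia) ltac:(lia).
split.
- lia.
- have [t'M lt' t'max] := ioP I.+1 ltac:(lia).
  have [tt'|tt'] := ltnP t (io I.+1); last first.
    right; suff -> : io I.+1 = t by lia.
    apply/eqP; rewrite eqn_leq tt' /= leqNgt; apply/negP => /(t'max _ tM); lia.
  left; have lE : l (io I.+1) = I.+1 by have := tmax _ t'M tt'; lia.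
  apply/eqP; rewrite eq_le Ky //= -{1}lE -Kl // lE p1max //.
  by have [] := lrN _ t'M; lia.
- exact: Ky.
- have [i [ti iM iI Ki]] : exists i, [/\ (t <= i)%N, (i < M)%N, (i + a <= I)%N &
      K (phi I) I <= K i I].
    have [pt|tp] := ltnP (phi I) t.
      by exists t; split=> //; apply: domL => //; lia.
    by exists (phi I); split=> //; lia.
  have ib := rng i ti iM.
  have := p1max i iM ltac:(lia); rewrite {1}/K cap_step; last lia.
  have := cD (I.+1 - i)%N (I.+1 - t)%N ltac:(lia) ltac:(lia) ltac:(lia).
  rewrite -/(K i I); lra.
(* Since [l t.+1] exceeds [I], [r t.+1] is at least [I.+2], so [domR] applies there. The shift to
   [t.+1] matches the shift of the edge by one: [I.+2 - i] is at least [I.+1 - t]. *)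
- have [i [ti iM iI Ki]] : exists i, [/\ (i <= t.+1)%N, (i < M)%N, (I.+2 <= i + b)%N &
      K (phi I.+2) I.+2 <= K i I.+2].
    have [tp|pt] := ltnP t.+1 (phi I.+2); last by exists (phi I.+2); split=> //; lia.
    have t1M : (t.+1 < M)%N by lia.
    have := tmax _ t1M (leqnn _); have := lrN _ t1M => -[h1 h2 h3] h4.
    by exists t.+1; split=> //; try lia; apply: domR => //; lia.
  have := p1max i iM ltac:(lia).
  have := cap_step c m (ltac:(lia) : (i <= I.+1)%N).
  have := cD (I.+1 - t)%N (I.+2 - i)%N ltac:(lia) ltac:(lia) ltac:(lia).
  rewrite -!/(K _ _); lra.
Qed.

(** * Counting the edges where slopes drop or disagree *)

Lemma envelope_slope_decr a b c y eps Phi lo H :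
    (forall I, (lo <= I)%N -> (I < H)%N -> envelope_at a b c y eps Phi I) ->
  forall I I', (lo <= I)%N -> (I <= I')%N -> (I' < H)%N ->
    slope c (eps I') <= slope c (eps I).
Proof.
move=> tr I I' lI; elim: I' => [|I' IH] II' I'H.
  by have -> : I = 0%N by lia.
have [->//|nII'] := eqVneq I I'.+1.
have {}IH := IH ltac:(lia) ltac:(lia).
(* The increment of [Phi] from [I'.+1] to [I'.+2] separates the two slopes. *)
have [_ _ _ _ h1] := tr I' ltac:(lia) ltac:(lia).
have [_ _ _ h2 _] := tr I'.+1 ltac:(lia) ltac:(lia).
lra.
Qed.

(** An edge of [c] cannot recur after a drop, as slopes never rise again; so [eps] is injective on
    drops. *)
Lemma card_slope_drops a b c y eps Phi lo H :
    (forall I, (lo <= I)%N -> (I < H)%N -> envelope_at a b c y eps Phi I) ->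
  (#|[set I : 'I_H | (lo < I)%N && (slope c (eps I) < slope c (eps I.-1))%R]| <= b)%N.
Proof.
move=> tr; apply: leq_trans (leq_subr a b).
apply: (@card_le_interval _ _ _ _ eps) => [I|I I'].
  by rewrite inE => /andP[lI _]; have [] := tr I ltac:(lia) (ltn_ord I).
rewrite !inE => /andP[lI _] /andP[lI' dI'] II' eqe.
have := envelope_slope_decr tr (ltnW lI) (ltac:(lia) : (I <= I'.-1)%N)
          (ltac:(have := ltn_ord I'; lia)).
by move: dI'; rewrite eqe; lra.
Qed.

(** On such edges [Phi - Phi'] strictly increases, so it is negative at the left end or positive at
    the right end. In the first case [eps] is injective, in the second [eps']: if a value recurred,
    the envelope lying below the other would miss [y] in between, and its edge index would advance
    at every step. *)
Lemma card_slope_gt a b c eps Phi a' b' c' eps' Phi' y lo H :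
    (forall I, (lo <= I)%N -> (I < H)%N -> envelope_at a b c y eps Phi I) ->
    (forall I, (lo <= I)%N -> (I < H)%N -> envelope_at a' b' c' y eps' Phi' I) ->
  (#|[set I : 'I_H | [&& (lo < I)%N, slope c' (eps' I.-1) <= slope c' (eps' I) &
       slope c' (eps' I) < slope c (eps I)]%R]| <= b + b')%N.
Proof.
move=> tr tr'; set S := [set _ | _].
(* The increment of [Phi'] is bounded only by the slope of the preceding edge, hence the condition
   that no drop occurs at [I]. The edge [I] stays the reference while [J] moves right, where the
   slopes of [Phi'] are no larger. *)
have grow (I J : nat) : (lo < I)%N -> (I <= J)%N -> (J < H)%N ->
    slope c' (eps' I.-1) <= slope c' (eps' I) -> slope c' (eps' I) < slope c (eps J) ->
    Phi J - Phi' J < Phi J.+1 - Phi' J.+1.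
  move=> lI IJ JH nd gt.
  have [_ _ _ h1 _] := tr J ltac:(lia) JH.
  have [_ _ _ _ ] := tr' J.-1 ltac:(lia) ltac:(lia).
  have -> : J.-1.+2 = J.+1 by lia.
  have -> : J.-1.+1 = J by lia.
  have := envelope_slope_decr tr' (ltac:(lia) : (lo <= I.-1)%N)
    (ltac:(lia) : (I.-1 <= J.-1)%N) (ltac:(lia)).
  lra.
pose S1 := [set I in S | Phi I - Phi' I < 0].
pose S2 := [set I in S | 0 < Phi I.+1 - Phi' I.+1].
have sub : S \subset S1 :|: S2.
  apply/fintype.subsetP => I IS; move: (IS); rewrite !inE => -> /=.
  have [//|D0] := ltP (Phi I - Phi' I) 0.
  move: IS; rewrite inE => /and3P[lI nd gt].
  have := grow _ _ lI (leqnn _) (ltn_ord I) nd gt; lra.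
have shift (e : nat -> nat) (I I' : nat) : (I <= I')%N ->
    (forall J, (I <= J)%N -> (J < I')%N -> e J.+1 = (e J).+1) ->
    (e I' = e I + (I' - I))%N.
  elim: I' => [|I' IH] II' step; first by (have -> : I = 0%N by lia); lia.
  have [->|nII'] := eqVneq I I'.+1; first by lia.
  rewrite step; [|lia|lia]; rewrite IH; [|lia|]; first by lia.
  by move=> J ? ?; apply: step; lia.
have D_mono (I J J' : nat) : (lo < I)%N -> (I <= J)%N -> (J <= J')%N -> (J' <= H)%N ->
    slope c' (eps' I.-1) <= slope c' (eps' I) ->
    (forall j, (J <= j)%N -> (j < J')%N -> slope c' (eps' I) < slope c (eps j)) ->
    Phi J - Phi' J <= Phi J' - Phi' J'.
  move=> lI IJ; elim: J' => [|J' IH] JJ' J'H nd gt; first by have -> : J = 0%N by lia.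
  have [->//|nJJ'] := eqVneq J J'.+1.
  apply: (le_trans (IH _ _ _ _)); [lia|lia|done| |].
    by move=> j ? ?; apply: gt; lia.
  by apply/ltW/(grow I); [lia|lia|lia|done|apply: gt; lia].
apply: leq_trans (subset_leq_card sub) _; apply: leq_trans (leq_card_setU _ _).1 _.
apply: leq_add.
- apply: leq_trans (leq_subr a b).
  apply: (@card_le_interval _ _ _ _ eps) => [I|I I'].
    by rewrite !inE => /andP[/and3P[lI _ _] _]; have [] := tr I ltac:(lia) (ltn_ord I).
  rewrite !inE => /andP[/and3P[lI nd gt] _] /andP[/and3P[lI' nd' gt'] neg] II' eqe.
  have I'H := ltn_ord I'.
  have gtj j : (I <= j)%N -> (j <= I')%N -> slope c' (eps' I) < slope c (eps j).
    move=> Ij jI'.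
    have := envelope_slope_decr tr (ltac:(lia) : (lo <= j)%N) jI' I'H.
    by rewrite -eqe; lra.
  suff : (eps I' = eps I + (I' - I))%N by lia.
  apply: shift => [|J IJ JI']; first by lia.
  have [_ [eqy|//] _ _ _] := tr J ltac:(lia) ltac:(lia).
  have [_ _ le _ _] := tr' J.+1 ltac:(lia) ltac:(lia).
  exfalso; have := D_mono I J.+1 I' lI ltac:(lia) ltac:(lia) (ltnW I'H) nd
    (fun j h h' => gtj j ltac:(lia) ltac:(lia)).
  lra.
- apply: leq_trans (leq_subr a' b').
  apply: (@card_le_interval _ _ _ _ eps') => [I|I I'].
    by rewrite !inE => /andP[/and3P[lI _ _] _]; have [] := tr' I ltac:(lia) (ltn_ord I).
  rewrite !inE => /andP[/and3P[lI nd gt] pos] /andP[/and3P[lI' nd' gt'] _] II' eqe.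
  have I'H := ltn_ord I'.
  have gtj j : (I <= j)%N -> (j <= I')%N -> slope c' (eps' I) < slope c (eps j).
    move=> Ij jI'.
    have := envelope_slope_decr tr (ltac:(lia) : (lo <= j)%N) jI' I'H.
    by rewrite eqe; lra.
  suff : (eps' I' = eps' I + (I' - I))%N by lia.
  apply: shift => [|J IJ JI']; first by lia.
  have [_ [eqy|//] _ _ _] := tr' J ltac:(lia) ltac:(lia).
  have [_ _ le _ _] := tr J.+1 ltac:(lia) ltac:(lia).
  exfalso; have := D_mono I I.+1 J.+1 lI ltac:(lia) ltac:(lia) ltac:(lia) nd
    (fun j h h' => gtj j ltac:(lia) ltac:(lia)).
  lra.
Qed.

(** The edges strictly between [n] and [8 * n] number [7 * n - 1]. For each [k] at most [b k] are
    drops and at most [2 * (b k + b j1)] disagree with [j1]; as [b j1] is least, this is at most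
    [5 * b k], in total [5 * n], which is less than [7 * n - 1]. *)
Lemma common_slope (s : nat) (hs : (0 < s)%N) (a b : 'I_s -> nat)
    (c : 'I_s -> nat -> R) y :
    (forall j, slope_decr (a j) (b j) (c j)) ->
    (forall j i, (i <= 8 * \sum_j b j)%N -> touches_twice (a j) (b j) (c j) y i) ->
  exists x, forall j, exists2 e : nat, (a j < e <= b j)%N & slope (c j) e = x.
Proof.
set n := (\sum_j b j)%N => cD yT.
(* Two touching points need two exponents; this excludes degree 0 and gives [0 < n], needed in the
   final count. *)
have bpos j : (0 < b j)%N by have [k1 [k2 [h1 h2 h3 _ _]]] := yT j 0%N isT; lia.
have bn j : (b j <= n)%N by rewrite /n (bigD1 j) //= leq_addr.
pose j0 := Ordinal hs.
have /choice [ep epP] : forall j, exists p : (nat -> nat) * (nat -> R),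
    forall I, (n <= I)%N -> (I < 8 * n)%N ->
      envelope_at (a j) (b j) (c j) y p.1 p.2 I.
  move=> j; have [|eps [Phi tr]] :=
    @envelope_exists _ _ _ y (8 * n).+1 (cD j) isT.
    by move=> i iM; apply: yT.
  by exists (eps, Phi) => I nI IH; apply: tr; have := bn j; have := bpos j; lia.
have [j1 _ j1min] := arg_minnP b (isT : xpredT j0).
pose eta j I := slope (c j) ((ep j).1 I).
have n0 : (0 < n)%N by apply: leq_trans (bpos j0) (bn j0).
pose S j k := [set I : 'I_(8 * n) | [&& (n < I)%N, eta k I.-1 <= eta k I & eta k I < eta j I]].
pose X j := [set I : 'I_(8 * n) | (n < I)%N && (eta j I < eta j I.-1)].
pose A := [set I : 'I_(8 * n) | (n < I)%N].
have [[I [nI IH eqI]]|noI] :=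
    pselect (exists I, [/\ (n < I)%N, (I < 8 * n)%N & forall j, eta j I = eta j1 I]).
  exists (eta j1 I) => j; exists ((ep j).1 I); last exact: eqI.
  by have [] := epP j I (ltnW nI) IH.
(* A drop of [j1] is charged to [X j1]; otherwise some [k] disagrees, and either it drops itself or
   the smaller of the two slopes belongs to a polynomial that does not drop. *)
have sub : A \subset \bigcup_k (X k :|: (S k j1 :|: S j1 k)).
  apply/fintype.subsetP => I; rewrite inE => nI.
  have [k nek] : exists k, eta k I != eta j1 I.
    apply: contrapT => h; apply: noI; exists I; split=> // j.
    by apply/eqP/negPn/negP => ne; apply: h; exists j.
  have [d1|nd1] := ltP (eta j1 I) (eta j1 I.-1).
    by apply/bigcupP; exists j1 => //; rewrite !inE nI d1.
  apply/bigcupP; exists k => //; rewrite !inE nI nd1 /=.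
  have [//|ndk] := ltP (eta k I) (eta k I.-1).
  by rewrite -neq_lt eq_sym.
have cA : (8 * n <= #|A| + n.+1)%N.
  rewrite -[X in (X <= _)%N](card_ord (8 * n)) -(cardsC A) leq_add2l.
  rewrite -[n.+1]subn0; apply: (@card_le_interval _ _ _ _ succn) => [I|I I'].
    by rewrite !inE; lia.
  lia.
have := leq_trans (subset_leq_card sub) (leq_card_bigcup _).
have : (\sum_k #|X k :|: (S k j1 :|: S j1 k)| <= \sum_k (5 * b k))%N.
  apply: leq_sum => k _; have := j1min k isT.
  have cX : (#|X k| <= b k)%N := card_slope_drops (epP k).
  have cS : (#|S k j1| <= b k + b j1)%N := card_slope_gt (epP k) (epP j1).
  have cS' : (#|S j1 k| <= b j1 + b k)%N := card_slope_gt (epP j1) (epP k).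
  have := (leq_card_setU (X k) (S k j1 :|: S j1 k)).1.
  have := (leq_card_setU (S k j1) (S j1 k)).1.
  move: cX cS cS'; clear; lia.
rewrite -big_distrr /= -/n; move=> h1 h2; exfalso.
have := leq_trans cA (leq_add (leq_trans h2 h1) (leqnn n.+1)); lia.
Qed.

End Caps.

Section ConvexForm.
Import Order.TTheory GRing.Theory Num.Theory.
Local Open Scope ring_scope.
Variable R : realType.
Implicit Types (f : tpoly R) (i k p q : nat).

(** * Newton polyhedra of polynomials in convex form *)

Definition supp f : {fset nat} := domf (tmonom f).
Definition fcoef f i : R := odflt 0 (tmonom f).[? i]%fmap.

Lemma fnd_fcoef f i : i \in supp f -> (tmonom f).[? i]%fmap = Some (fcoef f i).
Proof. by move=> fi; rewrite /fcoef in_fnd. Qed.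

Lemma fcoefE f (l : supp f) : tmonom f l = fcoef f (val l).
Proof. by rewrite /fcoef in_fnd; [exact: valP|move=> h; congr (tmonom f _); apply: val_inj]. Qed.

Lemma tcoef_in f i : i \in supp f -> tcoef f (Posz i) = (fcoef f i)%:E.
Proof. by move=> /fnd_fcoef /= ->. Qed.

Lemma tcoef_fin f (n : int) : tcoef f n \is a fin_num ->
  exists2 i, i \in supp f & n = Posz i.
Proof.
case: n => [i|//]; rewrite /tcoef; case: fndP => // fi _.
by exists i.
Qed.

(** Linear interpolation at [k] between the Newton points of exponents [p] and [q]. *)
Definition chord f p q k : R :=
  ((q%:R - k%:R) * fcoef f p + (k%:R - p%:R) * fcoef f q) / (q%:R - p%:R).

Lemma chord_in_hull f p q k : p \in supp f -> q \in supp f ->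
  (p < k)%N -> (k < q)%N -> convex_hull (newton_points f) (chord f p q k, k%:R).
Proof.
move=> fp fq pk kq C [/= Cconv subC].
have pkR : (p%:R : R) < k%:R by rewrite ltr_nat.
have kqR : (k%:R : R) < q%:R by rewrite ltr_nat.
pose t : R := (q%:R - k%:R) / (q%:R - p%:R).
have t0 : 0 <= t by rewrite divr_ge0 //; lra.
have t1 : t <= 1 by rewrite ler_pdivrMr; lra.
have Cp : (fcoef f p, p%:R) \in C.
  by rewrite inE; apply: subC; exists p => //=; exact: fnd_fcoef.
have Cq : (fcoef f q, q%:R) \in C.
  by rewrite inE; apply: subC; exists q => //=; exact: fnd_fcoef.
have := Cconv _ _ (Itv01 t0 t1) Cp Cq; rewrite inE.
suff -> : (chord f p q k, k%:R) =
  conv (Itv01 t0 t1) ((fcoef f p, p%:R) : convex_lmodType (R^o * R^o)%type) (fcoef f q, q%:R) by [].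
have qp0 : (q%:R : R) - p%:R != 0 by apply: lt0r_neq0; lra.
by congr (_, _); rewrite /= /GRing.scale /= /chord /t /onem; field.
Qed.

Lemma half_plane_conv (v t x a1 b1 a2 b2 l : R) : 0 <= l -> l <= 1 ->
  v + t * (b1 - x) <= a1 -> v + t * (b2 - x) <= a2 ->
  v + t * (l * b1 + (1 - l) * b2 - x) <= l * a1 + (1 - l) * a2.
Proof.
move=> l0 l1 h1 h2; have l1' : 0 <= 1 - l by lra.
have := lerD (ler_wpM2l l0 h1) (ler_wpM2l l1' h2); apply: le_trans.
by rewrite le_eqVlt; apply/orP; left; apply/eqP; ring.
Qed.

(** A half-plane is convex, so a line below all Newton points is below their hull. *)
Lemma hull_above f (v t x : R) : (forall i, i \in supp f -> v + t * (i%:R - x) <= fcoef f i) ->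
  forall al be : R, convex_hull (newton_points f) (al, be) -> v + t * (be - x) <= al.
Proof.
move=> above al be.
pose H : set (R^o * R^o) := fun z => (v + t * (z.2 - x) <= z.1).
suff sub : (convex_hull (newton_points f) `<=` H)%classic by move=> /sub.
apply: smallest_sub => [|[c z] [i /= fi ->]].
  move=> [a1 b1] [a2 b2] lam; rewrite !inE /H /= => h1 h2.
  rewrite /GRing.scale /= /onem.
  exact: half_plane_conv (ge0 lam) (le1 lam) h1 h2.
rewrite /H /=.
have := above i; rewrite /supp /fcoef.
by case: fndP fi => // fi [<-] -> //.
Qed.

Lemma chord_slope f p q k : (p < q)%N ->
  chord f p q k = fcoef f p + (fcoef f q - fcoef f p) / (q%:R - p%:R) * (k%:R - p%:R).
Proof.
move=> pq; have pqR : (p%:R : R) < q%:R by rewrite ltr_nat.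
have qp0 : (q%:R : R) - p%:R != 0 by apply: lt0r_neq0; lra.
by rewrite /chord; field.
Qed.

Lemma convex_form_below f p q k : convex_form f -> p \in supp f -> q \in supp f ->
  k \in supp f -> (p < k)%N -> (k < q)%N -> fcoef f k <= chord f p q k.
Proof.
move=> cf fp fq fk pk kq.
have [_] := (cf (Posz k) (fcoef f k)).1 (tcoef_in fk); apply.
by exists (chord f p q k) => //=; exact: chord_in_hull.
Qed.

(* Otherwise the lowest chord over [k] would be an edge of the Newton
   polyhedron crossing the line of exponent [k]. *)
Lemma convex_form_supp f p q k : convex_form f -> p \in supp f -> q \in supp f ->
  (p < k)%N -> (k < q)%N -> k \in supp f.
Proof.
move=> cf fp fq pk kq; apply: contrapT => /negP nk.
pose around := [pred u : supp f * supp f | (val u.1 < k)%N && (k < val u.2)%N].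
have around0 : around ([` fp], [` fq])%fset by rewrite /= pk kq.
case: (arg_minP (fun u : supp f * supp f => chord f (val u.1) (val u.2) k) around0).
move=> [[p1 fp1] [q1 fq1]] /= /andP[p1k kq1] umin.
have {}umin p2 q2 : p2 \in supp f -> q2 \in supp f -> (p2 < k)%N -> (k < q2)%N ->
    chord f p1 q1 k <= chord f p2 q2 k.
  by move=> fp2 fq2 p2k kq2; apply: (umin ([` fp2], [` fq2])%fset); rewrite /= p2k kq2.
pose v := chord f p1 q1 k.
pose t : R := (fcoef f q1 - fcoef f p1) / (q1%:R - p1%:R).
suff : tcoef f (Posz k) = v%:E by rewrite /tcoef not_fnd.
apply/cf; split; first by exists v => //=; exact: chord_in_hull.
move=> a' [a ha /= aa']; apply: le_trans aa'.
(* The line through the ends of the lowest chord supports the polyhedron: replacing by [i] the end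
   on the same side of [k] cannot lower the chord, which puts the point of exponent [i] above the
   line. *)
suff above i : i \in supp f -> v + t * (i%:R - k%:R) <= fcoef f i.
  by have := hull_above above ha; rewrite subrr mulr0 addr0.
have p1kR : (p1%:R : R) < k%:R by rewrite ltr_nat.
have kq1R : (k%:R : R) < q1%:R by rewrite ltr_nat.
have vE : v = fcoef f p1 + t * (k%:R - p1%:R) by apply: chord_slope; lia.
have vE' : v = fcoef f q1 - t * (q1%:R - k%:R).
  have : t * (q1%:R - p1%:R) = fcoef f q1 - fcoef f p1.
    by rewrite /t divfK //; apply: lt0r_neq0; lra.
  rewrite vE; lra.
move=> fi; case: (ltngtP i k) => ik; last by move: nk; rewrite -ik fi.
- have ikR : (i%:R : R) < k%:R by rewrite ltr_nat.
  have := umin i q1 fi fq1 ik kq1; rewrite -/v /chord ler_pdivlMr; last lra.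
  move=> h; rewrite -(ler_pM2r (_ : 0 < q1%:R - k%:R)); last by lra.
  move: h; rewrite vE'; nra.
- have ikR : (k%:R : R) < i%:R by rewrite ltr_nat.
  have := umin p1 i fp1 fi p1k ik; rewrite -/v /chord ler_pdivlMr; last lra.
  move=> h; rewrite -(ler_pM2r (_ : 0 < k%:R - p1%:R)); last by lra.
  move: h; rewrite vE; nra.
Qed.

Lemma supp_interval f : convex_form f -> exists2 a, (a <= trdeg f)%N &
  forall i, (i \in supp f) = (a <= i <= trdeg f)%N.
Proof.
move=> cf.
have ex : exists i, i \in supp f.
  apply: contrapT => h; have := tmonom_neq0 f; apply/negP/negPn/eqP.
  apply/fmapP => i; rewrite !not_fnd // ?inE //.
  by apply/negP => fi; apply: h; exists i.
have bd i : i \in supp f -> (i <= trdeg f)%N.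
  by move=> fi; rewrite /trdeg (big_fsetD1 i) //= leq_maxl.
have [b fb bmax] := ex_maxnP ex bd; have [a fa amin] := ex_minnP ex.
have bE : trdeg f = b.
  apply/eqP; rewrite eqn_leq bd // andbT; apply/bigmax_leqP_seq => i fi _.
  exact: bmax.
exists a; rewrite bE; first exact: bmax.
move=> i; apply/idP/idP => [fi|/andP[ai ib]]; first by rewrite amin // bmax.
have [<-//|ai'] := eqVneq a i; have [->//|ib'] := eqVneq i b.
by apply: (convex_form_supp cf fa fb); lia.
Qed.

(** Among three consecutive exponents the middle coefficient is at most the chord of its
    neighbours. *)
Lemma convex_form_slope_decr f a : convex_form f ->
  (forall i, (i \in supp f) = (a <= i <= trdeg f)%N) ->
  slope_decr a (trdeg f) (fcoef f).
Proof.
move=> cf suppE e e' ae; elim: e' => [|e' IH] ee' e'b.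
  by have -> : e = 0%N by lia.
have [->//|nee'] := eqVneq e e'.+1.
apply: le_trans (IH _ _); [|lia|lia].
case: e' nee' e'b ee' {IH} => [|k] nee' kb ek; first by lia.
have := @convex_form_below f k k.+2 k.+1 cf.
rewrite !suppE => /(_ ltac:(lia) ltac:(lia) ltac:(lia) (leqnn _) (leqnn _)).
rewrite /chord /slope /=; have k0 : (0 : R) <= k%:R by exact: ler0n.
rewrite -!natr1 ler_pdivlMr; last lra.
nra.
Qed.

(** * From slopes to tropical zeros *)

Lemma slope_decr_min (a b e : nat) (c : nat -> R) : slope_decr a b c ->
  (a < e <= b)%N -> forall k, (a <= k <= b)%N ->
  c e + slope c e *+ e <= c k + slope c e *+ k.
Proof.
move=> cD aeb; pose g k := c k + slope c e *+ k.
(* So [g] does not increase up to [e] and does not decrease from there on. *)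
have step k : g k = g k.+1 + (slope c k.+1 - slope c e).
  by rewrite /g mulrS /slope /=; lra.
have up k : (e <= k)%N -> (k <= b)%N -> g e <= g k.
  elim: k => [|k IH] ek kb; first by have -> : e = 0%N by lia.
  have [->//|nek] := eqVneq e k.+1.
  have := IH ltac:(lia) ltac:(lia).
  have := step k; have := cD e k.+1 ltac:(lia) ltac:(lia) kb; lra.
have down d : (d <= e - a)%N -> g e <= g (e - d)%N.
  elim: d => [|d IH] da; first by rewrite subn0.
  have := IH ltac:(lia); have := step (e - d.+1)%N.
  have -> : (e - d.+1).+1 = (e - d)%N by lia.
  have := cD (e - d)%N e ltac:(lia) ltac:(lia) ltac:(lia); lra.
move=> k akb; rewrite -!/(g _); have [ek|ke] := leqP e k; first by apply: up; lia.
have -> : k = (e - (e - k))%N by lia.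
by apply: down; lia.
Qed.

Lemma tzero_slope f a e : convex_form f ->
  (forall i, (i \in supp f) = (a <= i <= trdeg f)%N) ->
  (a < e <= trdeg f)%N -> tzero f (slope (fcoef f) e).
Proof.
case: e => [|e] cf suppE aeb; first by lia.
have fe : e.+1 \in supp f by rewrite suppE; lia.
have fe' : e \in supp f by rewrite suppE; lia.
exists [` fe']%fset, [` fe]%fset.
have eqv : fcoef f e + slope (fcoef f) e.+1 *+ e = fcoef f e.+1 + slope (fcoef f) e.+1 *+ e.+1.
  by rewrite mulrS addrA; congr (_ + _); rewrite /slope /=; lra.
split.
- by move=> /(congr1 val) /=; lia.
- by rewrite /= !fcoefE /= eqv.
move=> l; rewrite /= !fcoefE /= lee_fin eqv.
apply: (slope_decr_min (convex_form_slope_decr cf suppE) aeb).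
by rewrite -suppE; exact: valP.
Qed.

(** * Zeros of the Cayley matrix *)

Section Cayley.
Variables (s : nat) (f : 'I_s -> tpoly R) (N : nat).

Let row (k : int * 'I_s) (h : k \in @cayley_rows s N) : cayley_rows N := exist _ k h.
Let col I (h : I \in cayley_cols f N) : cayley_cols f N := exist _ I h.

(** With the value [I x] in column [I], row [(i, j)] shows the monomials of [f j] evaluated at [x],
    all shifted by [i x]. *)
Lemma cayley_tzero (x : R) : (forall j, tzero (f j) x) ->
  mx_tzero (cayleyN f N) (fun I => x *~ val I).
Proof.
move=> xf [[i j] /= ij]; have [l1 [l2 [l12 eql lmin]]] := xf j.
have inC (l : supp (f j)) : ((val l)%:Z + i)%R \in cayley_cols f N.
  apply/mem_set; exists (i, j); first exact: set_mem ij.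
  by rewrite /cayley /= addrK tcoef_in //; exact: valP.
have val_l (l : supp (f j)) : (cayleyN f N (row ij) (col (inC l)) +
    (x *~ ((val l)%:Z + i))%:E)%E = ((tmonom (f j) l + x *+ val l)%:E + (x *~ i)%:E)%E.
  rewrite /cayleyN /cayley /= addrK tcoef_in; last exact: valP.
  by rewrite -!EFinD fcoefE mulrzDr addrA.
exists (col (inC l1)), (col (inC l2)); split.
- move=> /(congr1 val) /= /(addIr i) /eqP; rewrite eqz_nat => /eqP h.
  by apply: l12; apply: val_inj.
- by rewrite !val_l eql.
move=> [I Ic]; rewrite val_l /cayleyN /cayley /=.
have [/tcoef_fin[k fk kE]|] := boolP (tcoef (f j) (I - i) \is a fin_num).
  have -> : I = (k%:Z + i)%R by rewrite -kE subrK.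
  rewrite addrK tcoef_in // mulrzDr -!EFinD addrA lee_fin lerD2r.
  by have := lmin [` fk]%fset; rewrite [tmonom _ [` fk]%fset]fcoefE lee_fin.
rewrite /tcoef; case: (I - i) => [k|k]; last by rewrite leey.
by case: fndP => // _ _; rewrite leey.
Qed.

Lemma cayley_touches_twice (y : cayley_cols f N -> R) :
  mx_tzero (cayleyN f N) y ->
  exists Y : nat -> R, forall j a i, (a <= trdeg (f j))%N ->
    (forall i, (i \in supp (f j)) = (a <= i <= trdeg (f j))%N) ->
    (i <= 2 * N)%N -> touches_twice a (trdeg (f j)) (fcoef (f j)) Y i.
Proof.
move=> yz.
(* Translation by [N] makes rows and columns natural numbers, the rows becoming 0 to [2 * N]; 0 is a
   filler away from the columns of the matrix. *)
pose Y (I : nat) := if pselect ((I%:Z - N%:Z)%R \in cayley_cols f N) is left h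
  then y (col h) else 0.
have YE I (J : cayley_cols f N) : val J = (I%:Z - N%:Z)%R -> Y I = y J.
  move=> JI; rewrite /Y; case: pselect => [h|]; last by rewrite -JI; case; exact: valP.
  by congr y; apply: val_inj; rewrite /= -JI.
exists Y => j a i ab suppE iN.
have rN : ((i%:Z - N%:Z)%R, j) \in @cayley_rows s N.
  by apply/mem_set; rewrite /cayley_rows /=; lia.
pose v J := (cayleyN f N (row rN) J + (y J)%:E)%E.
have [J1 [J2 [J12 eqJ Jmin]]] : min_twice v := yz _.
have inC k : k \in supp (f j) -> exists2 J : cayley_cols f N,
    val J = ((i + k)%:Z - N%:Z)%R & v J = (fcoef (f j) k + Y (i + k)%N)%:E.
  move=> fk.
  have kC : ((i + k)%:Z - N%:Z)%R \in cayley_cols f N.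
    apply/mem_set; exists ((i%:Z - N%:Z)%R, j); first exact: set_mem rN.
    rewrite /cayley /=; have -> : ((i + k)%:Z - N%:Z - (i%:Z - N%:Z) = Posz k)%R by lia.
    by rewrite tcoef_in.
  exists (col kC) => //; rewrite /v /cayleyN /cayley /=.
  have -> : ((i + k)%:Z - N%:Z - (i%:Z - N%:Z) = Posz k)%R by lia.
  by rewrite tcoef_in // (YE _ (col kC)).
(* The leading monomial gives one finite value, so the row minimum is finite and can only be
   attained at finite entries. *)
have [Jb _ vJb] := inC (trdeg (f j)) ltac:(rewrite suppE; lia).
have fin J : (v J <= v Jb)%E -> exists k, [/\ k \in supp (f j),
    val J = ((i + k)%:Z - N%:Z)%R & v J = (fcoef (f j) k + Y (i + k)%N)%:E].
  rewrite vJb => le.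
  have : cayleyN f N (row rN) J \is a fin_num.
    move: le; rewrite /v /cayleyN /cayley /= /tcoef.
    by case: (val J - _)%R => // k; case: fndP.
  rewrite /cayleyN /cayley /= => /tcoef_fin[k fk kE].
  have JE : val J = ((i + k)%:Z - N%:Z)%R .
    by have := congr1 (+%R^~ (i%:Z - N%:Z)%R) kE; rewrite /= subrK => ->; lia.
  exists k; split=> //.
  by rewrite /v /cayleyN /cayley /= kE tcoef_in // (YE _ _ JE).
have [k1 [fk1 J1E vJ1]] := fin J1 (Jmin _).
have [k2 [fk2 J2E vJ2]] := fin J2 ltac:(rewrite -eqJ; exact: Jmin).
have k12 : k1 <> k2 by move=> k12; apply: J12; apply: val_inj; rewrite J1E J2E k12.
have kmin k : (a <= k <= trdeg (f j))%N ->
    fcoef (f j) k1 + Y (i + k1)%N <= fcoef (f j) k + Y (i + k)%N.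
  rewrite -suppE => /inC [J _ vJ].
  by have := Jmin J; rewrite vJ1 vJ lee_fin.
have eqk : fcoef (f j) k1 + Y (i + k1)%N = fcoef (f j) k2 + Y (i + k2)%N.
  by move: eqJ; rewrite vJ1 vJ2 => -[].
move: fk1 fk2; rewrite !suppE => /andP[ak1 k1b] /andP[ak2 k2b].
case: (ltngtP k1 k2) => // lt; first by exists k1, k2.
by exists k2, k1; split=> // k /kmin; rewrite eqk.
Qed.

End Cayley.

End ConvexForm.

Theorem theorem4p1 (R : realType) (s : nat) (hs : (0 < s)%N) :
  exists N : ('I_s -> nat) -> nat,
    (forall d : 'I_s -> nat, (N d <= 4 * \sum_(j < s) d j)%N) /\
    (forall f : 'I_s -> tpoly R, (forall j, convex_form (f j)) ->
      ((exists x : R, forall j, tzero (f j) x) <->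
       (exists y, mx_tzero (cayleyN f (N (fun j => trdeg (f j)))) y))).
Proof.
(* With this [N] the offsets 0 to [2 * N] are exactly the [8 * n + 1] rows that [common_slope] asks
   for. *)
exists (fun d => (4 * \sum_(j < s) d j)%N); split=> // f cf; split=> [[x xf]|[y yz]].
  by exists (fun I => (x *~ val I)%R); exact: cayley_tzero.
have [Y YT] := cayley_touches_twice yz.
have /choice [a aP] : forall j, exists a, (a <= trdeg (f j))%N /\
    forall i, (i \in supp (f j)) = (a <= i <= trdeg (f j))%N.
  by move=> j; have [a] := supp_interval (cf j); exists a.
have [j|j i iM|x xP] := common_slope hs (a := a) (b := fun j => trdeg (f j))
    (c := fun j => fcoef (f j)) (y := Y).
- exact: convex_form_slope_decr (aP j).2.
- by apply: YT; [exact: (aP j).1|exact: (aP j).2|rewrite mulnA].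
exists x => j; have [e aeb <-] := xP j.
exact: tzero_slope (aP j).2 aeb.
Qed.
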